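(* Let $H$ and $A$ be weak Hopf algebras over $\Bbbk$ with antipodes $S_H$ and $S_A$, and let $(H,A)$ be a compatible weak matched pair such that, for all $h\in H$, $$(1_{H1}h^0\cdot 1_A)\otimes S_A(h^1)\varepsilon_s({1_{H2}}^1)\otimes {1_{H2}}^0=\varepsilon_t({1_{H1}}^0h^0\cdot 1_A)\otimes\varepsilon_t(h^1)\varepsilon_s({1_{H2}}^1){1_{H1}}^1\otimes{1_{H2}}^0,$$ $$\varepsilon_s({h_1}^1{h_2}^1)(S_H({h_1}^0)\cdot 1_A)\otimes S_H({h_2}^0)h_3=\varepsilon_s(h^1{1_{H2}}^1)\varepsilon_s(h^01_{H1}\cdot 1_A)\otimes{1_{H2}}^0,$$ so that $A\underline{\overline{\#}}H$ is a weak Hopf algebra. Let $\alpha\in\int_\ell^A$ and $t\in\int_\ell^H$ be such that $$(h\cdot\alpha)\varepsilon_s({t_1}^1(t_2\cdot 1_A))\otimes{t_1}^0=(h^0\cdot 1_A)\varepsilon_s(h^1)\alpha\,\varepsilon_s({t_1}^1(t_2\cdot 1_A))\otimes{t_1}^0$$ for all $h\in H$. Then $\alpha\underline{\overline{\#}}t\in\int_\ell^{A\underline{\overline{\#}}H}$.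
   Context: Everything is over a fixed field $\Bbbk$, $\otimes=\otimes_\Bbbk$; algebras are associative and unital, coalgebras coassociative and counital; Sweedler notation $\Delta(h)=h_1\otimes h_2$ (summation understood). A weak bialgebra $H$ is an algebra and a coalgebra such that $\Delta(hk)=\Delta(h)\Delta(k)$; $\varepsilon(hk\ell)=\varepsilon(hk_1)\varepsilon(k_2\ell)=\varepsilon(hk_2)\varepsilon(k_1\ell)$; and $(1_H\otimes\Delta(1_H))(\Delta(1_H)\otimes 1_H)=(\Delta(1_H)\otimes 1_H)(1_H\otimes\Delta(1_H))=\Delta^2(1_H)$, where $\Delta^2=(\Delta\otimes \mathrm{id})\Delta$. Write $\Delta(1_H)=1_{H1}\otimes 1_{H2}$; primes denote further copies. Put $\varepsilon_t(h)=\varepsilon(1_{H1}h)1_{H2}$ and $\varepsilon_s(h)=1_{H1}\varepsilon(h1_{H2})$ (similarly for $A$). A weak Hopf algebra is a weak bialgebra with a linear map $S:H\to H$ (antipode) with $h_1S(h_2)=\varepsilon_t(h)$, $S(h_1)h_2=\varepsilon_s(h)$, $S(h_1)h_2S(h_3)=S(h)$. A left integral in a weak Hopf algebra $H$ is an element $\alpha\in H$ with $h\alpha=\varepsilon_t(h)\alpha$ for all $h\in H$; $\int_\ell^H$ denotes the space of left integrals in $H$. For a weak bialgebra $H$ and an algebra $A$, $A$ is a left $H$-module algebra if there is a linear map $\cdot:H\otimes A\to A$ with $1_H\cdot a=a$; $h\cdot ab=(h_1\cdot a)(h_2\cdot b)$; $h\cdot(k\cdot a)=hk\cdot a$; $h\cdot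 1_A=\varepsilon_t(h)\cdot 1_A$. For a weak bialgebra $A$ and a coalgebra $H$, $H$ is a right $A$-comodule coalgebra if there is a linear map $\rho:H\to H\otimes A$, $\rho(h)=h^0\otimes h^1$, with $\varepsilon(h^1)h^0=h$; ${h^0}_1\otimes{h^0}_2\otimes h^1={h_1}^0\otimes{h_2}^0\otimes{h_1}^1{h_2}^1$; $h^{00}\otimes h^{01}\otimes h^1=h^0\otimes{h^1}_1\otimes{h^1}_2$; $h^1\varepsilon(h^0)=\varepsilon_s(h^1)\varepsilon(h^0)$. Here $h^{00}\otimes h^{01}\otimes h^1=(\rho\otimes\mathrm{id})\rho(h)$, ${h_1}^0\otimes {h_1}^1$ is $\rho$ applied to the leg $h_1$, and ${h^0}_1\otimes{h^0}_2$ is $\Delta$ applied to the leg $h^0$. A pair $(H,A)$ of weak bialgebras is a weak matched pair if: (i) $A$ is a left $H$-module algebra via $\cdot$; (ii) $H$ is a right $A$-comodule coalgebra via $\rho$; (iii) $(h_2g)^0\otimes(h_1\cdot x)_1\otimes(h_1\cdot x)_2(h_2g)^1={h_3}^0g^0\otimes({h_1}^0\cdot x_1)\otimes{h_1}^1(h_2\cdot x_2){h_3}^1(h_4\cdot g^1)$; (iv) $\varepsilon_s(h\cdot x)=\varepsilon_s(h\cdot 1_A)\varepsilon_s(x)$; (v) $\rho(1_{H1})\otimes 1_{H2}=1_{H1}\otimes\varepsilon({1_{H1}'}^0){1_{H1}'}^1\otimes 1_{H2}1_{H2}'$; for all $h,g\in H$, $x\in A$. It is abelian if $H$ is cocommutative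 and $A$ is commutative. A compatible weak matched pair is an abelian weak matched pair such that, for all $h,g\in H$: $h\cdot 1_A=h_1\cdot 1_{A1}\,\varepsilon(h_2\cdot 1_{A2})$ and $h\cdot 1_{A1}\otimes g\cdot 1_{A2}=(h\cdot 1_A)1_{A1}\otimes(g\cdot 1_A)1_{A2}$. $A\#H$ denotes $A\otimes H$ (with $x\#h=x\otimes h$) equipped with the product $(x\#h)(y\#g)=x(h_1\cdot y)\#h_2g$, the map $\Delta(x\#h)=x_1\#{h_1}^0\otimes x_2{h_1}^1\#h_2$, and $\varepsilon(x\#h)=\varepsilon(x)\varepsilon(h)$. Put $x\underline{\#}h=(x\#h)(1_A\#1_H)=x(h_1\cdot 1_A)\#h_2$, and $x\underline{\overline{\#}}h=(\mathrm{id}\otimes\varepsilon)\Delta(x\underline{\#}h)=x_1({h_1}^0\cdot 1_A)\#{h_2}^0\,\varepsilon(x_2{h_1}^1{h_2}^1(h_3\cdot 1_A))$. $A\underline{\overline{\#}}H$ is the image of the linear map $A\otimes H\to A\otimes H$, $x\otimes h\mapsto x\underline{\overline{\#}}h$. Under the two conditions on $(H,A)$ displayed first in the claim it is a weak Hopf algebra with multiplication $(x\underline{\overline{\#}}h)(y\underline{\overline{\#}}g)=x(h_1\cdot y)\underline{\overline{\#}}h_2g$, unity $1_A\underline{\overline{\#}}1_H$, comultiplication $\Delta(x\underline{\overline{\#}}h)=x_1\underline{\overline{\#}}{h_1}^0\otimes x_2{h_1}^1\underline{\overline{\#}}h_2$, counit $\varepsilon(x\underline{\overline{\#}}h)=\varepsilon(x({h_1}^0\cdot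 1_A){h_1}^1(h_2\cdot 1_A))$ and antipode $S(x\underline{\overline{\#}}h)=(1_A\underline{\overline{\#}}S_H(h^0))(S_A(xh^1)\underline{\overline{\#}}1_H)$. *)

(* Defs.v *)
From HB Require Import structures.
From mathcomp Require Import all_boot all_algebra.
From mathcomp Require Import boolp.

Set Implicit Arguments.
Unset Strict Implicit.
Unset Printing Implicit Defensive.

Import GRing.Theory.
Local Open Scope ring_scope.
Local Open Scope quotient_scope.

(* Tensor products over a field, without any finiteness assumption.  An element
   of [tensor U V] is a finite formal sum of pairs [(u, v)] (scalars are absorbed
   in [u]), two sums being identified when every bilinear map takes the same
   value on both. *)
Section Tensor.
Variables (K : fieldType) (U V : lmodType K).

Definition bilin (W : lmodType K) (f : U -> V -> W) : Prop :=
  (forall v, linear (f^~ v)) /\ (forall u, linear (f u)).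

Definition eval_sum (W : nmodType) (f : U -> V -> W) (s : seq (U * V)) : W :=
  \sum_(p <- s) f p.1 p.2.

Definition tensor_eq : rel (seq (U * V)) := fun s t =>
  `[< forall (W : lmodType K) (f : U -> V -> W), bilin f ->
        eval_sum f s = eval_sum f t >].

Fact tensor_eq_refl : reflexive tensor_eq.
Proof. by move=> s; apply/asboolP. Qed.

Fact tensor_eq_sym : symmetric tensor_eq.
Proof. by move=> s t; apply/asboolP/asboolP => st W f bf; rewrite st. Qed.

Fact tensor_eq_trans : transitive tensor_eq.
Proof.
move=> t s r /asboolP st /asboolP tr; apply/asboolP => W f bf.
by rewrite st ?tr.
Qed.

Canonical tensor_equiv :=
  EquivRel tensor_eq tensor_eq_refl tensor_eq_sym tensor_eq_trans.

Definition tensor := {eq_quot tensor_equiv}.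

HB.instance Definition _ := Choice.on tensor.

Definition tpure (u : U) (v : V) : tensor := \pi_tensor [:: (u, v)].

(* The linear map out of the tensor product induced by [f], in the form of
   Sweedler notation: the sum of the [f u v] over the terms of a decomposition
   of [t] into pure tensors.  The result does not depend on the decomposition
   when [f] is bilinear (lemma [tsum_pi]); no other [f] is ever used. *)
Definition tsum (W : nmodType) (t : tensor) (f : U -> V -> W) : W :=
  eval_sum f (repr t).

Lemma tsum_pi (W : lmodType K) (f : U -> V -> W) s :
  bilin f -> tsum (\pi_tensor s) f = eval_sum f s.
Proof.
move=> bf; rewrite /tsum; case: piP => t /eqmodP /asboolP st.
by rewrite st.
Qed.

Lemma tensor_ext (s t : tensor) :
  (forall (W : lmodType K) (f : U -> V -> W), bilin f -> tsum s f = tsum t f) ->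
  s = t.
Proof.
by move=> st; rewrite -[s]reprK -[t]reprK; apply/eqmodP/asboolP.
Qed.

Definition tensor_zero : tensor := \pi_tensor [::].
Definition tensor_add (s t : tensor) : tensor := \pi_tensor (repr s ++ repr t).
Definition tensor_scale (c : K) (s : tensor) : tensor :=
  \pi_tensor [seq (c *: p.1, p.2) | p <- repr s].
Definition tensor_opp (s : tensor) : tensor := tensor_scale (- 1) s.

Section Eval.
Variables (W : lmodType K) (f : U -> V -> W).
Hypothesis bf : bilin f.

Let fl v : linear (f^~ v). Proof. by case: bf. Qed.

Let f0l v : f 0 v = 0.
Proof.
have := fl v (-1) 0 0; rewrite [_ + 0]addr0 scaler0 => /= ->.
by rewrite scaleN1r addNr.
Qed.

Lemma bilinZl c u v : f (c *: u) v = c *: f u v.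
Proof. by have /= := fl v c u 0; rewrite !addr0 f0l addr0. Qed.

Lemma tsum_zero : tsum tensor_zero f = 0.
Proof. by rewrite tsum_pi // /eval_sum big_nil. Qed.

Lemma tsum_add s t : tsum (tensor_add s t) f = tsum s f + tsum t f.
Proof. by rewrite tsum_pi // /eval_sum big_cat. Qed.

Lemma tsum_scale c s : tsum (tensor_scale c s) f = c *: tsum s f.
Proof.
rewrite tsum_pi // /eval_sum big_map scaler_sumr.
by apply: eq_bigr => p _; rewrite bilinZl.
Qed.

Lemma tsum_pure u v : tsum (tpure u v) f = f u v.
Proof. by rewrite tsum_pi // /eval_sum big_seq1. Qed.

End Eval.

Fact tensor_addA : associative tensor_add.
Proof. by move=> r s t; apply: tensor_ext => W f bf; rewrite !tsum_add ?addrA. Qed.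
Fact tensor_addC : commutative tensor_add.
Proof. by move=> s t; apply: tensor_ext => W f bf; rewrite !tsum_add // addrC. Qed.
Fact tensor_add0 : left_id tensor_zero tensor_add.
Proof.
by move=> s; apply: tensor_ext => W f bf; rewrite tsum_add // tsum_zero // add0r.
Qed.
Fact tensor_addN : left_inverse tensor_zero tensor_opp tensor_add.
Proof.
move=> s; apply: tensor_ext => W f bf.
by rewrite tsum_add // tsum_scale // tsum_zero // scaleN1r addNr.
Qed.

HB.instance Definition _ := GRing.isZmodule.Build tensor
  tensor_addA tensor_addC tensor_add0 tensor_addN.

Fact tensor_scaleA c d s :
  tensor_scale c (tensor_scale d s) = tensor_scale (c * d) s.
Proof. by apply: tensor_ext => W f bf; rewrite !tsum_scale // scalerA. Qed.
Fact tensor_scale1 : left_id 1 tensor_scale.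
Proof. by move=> s; apply: tensor_ext => W f bf; rewrite tsum_scale // scale1r. Qed.
Fact tensor_scaleDr : right_distributive tensor_scale +%R.
Proof.
move=> c s t; apply: tensor_ext => W f bf.
by rewrite tsum_scale // !tsum_add // !tsum_scale // scalerDr.
Qed.
Fact tensor_scaleDl s : {morph tensor_scale^~ s : c d / c + d}.
Proof.
move=> c d; apply: tensor_ext => W f bf.
by rewrite tsum_add // !tsum_scale // scalerDl.
Qed.

HB.instance Definition _ := GRing.Zmodule_isLmodule.Build K tensor
  tensor_scaleA tensor_scale1 tensor_scaleDr tensor_scaleDl.

(* The next three facts say that [tensor U V], with [tpure], is the tensor
   product of [U] and [V]: [tpure] is bilinear, pure tensors span, and every
   bilinear map [f] factors through the linear map [tsum^~ f]. *)
Fact tpure_bilin : bilin tpure.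
Proof.
split=> [v c u u'|u c v v']; apply: tensor_ext => W f bf.
  have [fl _] := bf.
  by rewrite [LHS]tsum_pure // [RHS]tsum_add // tsum_scale // !tsum_pure // fl.
have [_ fr] := bf.
by rewrite [LHS]tsum_pure // [RHS]tsum_add // tsum_scale // !tsum_pure // fr.
Qed.

Fact tensor_span (t : tensor) :
  exists s : seq (U * V), t = \sum_(p <- s) tpure p.1 p.2.
Proof.
exists (repr t); apply: tensor_ext => W f bf.
transitivity (eval_sum f (repr t)) => //.
elim: (repr t) => [|p s IHs].
  by rewrite big_nil [RHS]tsum_zero // /eval_sum big_nil.
by rewrite big_cons [RHS]tsum_add // -IHs tsum_pure // /eval_sum big_cons.
Qed.

Fact tsum_linear (W : lmodType K) (f : U -> V -> W) :
  bilin f -> linear (fun t : tensor => tsum t f).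
Proof. by move=> bf c s t; rewrite [LHS]tsum_add // tsum_scale. Qed.

End Tensor.

Arguments tpure {K U V}.
Arguments tsum {K U V W}.

Notation "U ⊗ V" := (tensor U V)
  (at level 40, left associativity) : type_scope.
Notation "u ⊗ v" := (tpure u v)
  (at level 40, left associativity) : ring_scope.
Notation "\tsum_ ( a , b <- t ) e" := (tsum t (fun a b => e))
  (at level 41, a name, b name, t at level 200, e at level 41, right associativity,
   format "'[' \tsum_ ( a ,  b  <-  t )  '/' e ']'") : ring_scope.

HB.mixin Record isCoalgebra (K : fieldType) C of GRing.Lmodule K C := {
  comul : {linear C -> (C ⊗ C)%type};
  counit : {scalar C};
  coassoc : forall h : C,
    \tsum_(a, b <- comul h) \tsum_(a1, a2 <- comul a) a1 ⊗ a2 ⊗ b =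
    \tsum_(a, b <- comul h) \tsum_(b1, b2 <- comul b) a ⊗ b1 ⊗ b2;
  counitl : forall h : C, \tsum_(a, b <- comul h) counit a *: b = h;
  counitr : forall h : C, \tsum_(a, b <- comul h) counit b *: a = h
}.

#[short(type="coalgType")]
HB.structure Definition Coalgebra (K : fieldType) :=
  {C of GRing.Lmodule K C & isCoalgebra K C}.

Notation "'Δ'" := comul : ring_scope.
Notation "'ε'" := counit : ring_scope.

Definition cocommutative (K : fieldType) (C : coalgType K) : Prop :=
  forall h : C, Δ h = \tsum_(h1, h2 <- Δ h) h2 ⊗ h1.

HB.mixin Record isWeakBialgebra (K : fieldType) H
    of GRing.Algebra K H & Coalgebra K H := {
  comulM : forall h k : H,
    Δ (h * k) =
    \tsum_(h1, h2 <- Δ h) \tsum_(k1, k2 <- Δ k) (h1 * k1) ⊗ (h2 * k2);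
  counitM12 : forall h k l : H,
    ε (h * k * l) = \tsum_(k1, k2 <- Δ k) ε (h * k1) * ε (k2 * l) :> K;
  counitM21 : forall h k l : H,
    ε (h * k * l) = \tsum_(k1, k2 <- Δ k) ε (h * k2) * ε (k1 * l) :> K;
  comul1_12 :
    \tsum_(a, b <- Δ (1 : H)) \tsum_(a', b' <- Δ (1 : H))
      a' ⊗ (a * b') ⊗ b =
    \tsum_(a, b <- Δ (1 : H)) \tsum_(a1, a2 <- Δ a) a1 ⊗ a2 ⊗ b;
  comul1_21 :
    \tsum_(a, b <- Δ (1 : H)) \tsum_(a', b' <- Δ (1 : H))
      a ⊗ (b * a') ⊗ b' =
    \tsum_(a, b <- Δ (1 : H)) \tsum_(a1, a2 <- Δ a) a1 ⊗ a2 ⊗ b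
}.

#[short(type="weakBialgType")]
HB.structure Definition WeakBialgebra (K : fieldType) :=
  {H of GRing.Algebra K H & Coalgebra K H & isWeakBialgebra K H}.

Definition eps_t (K : fieldType) (H : weakBialgType K) (h : H) : H :=
  \tsum_(a, b <- Δ (1 : H)) ε (a * h) *: b.

Definition eps_s (K : fieldType) (H : weakBialgType K) (h : H) : H :=
  \tsum_(a, b <- Δ (1 : H)) ε (h * b) *: a.

Notation "'εt'" := eps_t : ring_scope.
Notation "'εs'" := eps_s : ring_scope.

HB.mixin Record isWeakHopf (K : fieldType) H of WeakBialgebra K H := {
  antipode : {linear H -> H};
  antipodeR : forall h : H, \tsum_(h1, h2 <- Δ h) h1 * antipode h2 = εt h;
  antipodeL : forall h : H, \tsum_(h1, h2 <- Δ h) antipode h1 * h2 = εs h;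
  antipodeLR : forall h : H,
    \tsum_(h1, h' <- Δ h) \tsum_(h2, h3 <- Δ h')
      antipode h1 * h2 * antipode h3 = antipode h
}.

#[short(type="weakHopfType")]
HB.structure Definition WeakHopf (K : fieldType) :=
  {H of WeakBialgebra K H & isWeakHopf K H}.

Definition left_integral (K : fieldType) (H : weakHopfType K) (a : H) : Prop :=
  forall h : H, h * a = εt h * a.

Record is_module_algebra (K : fieldType) (H : weakBialgType K) (A : algType K)
    (act : H -> A -> A) : Prop := IsModuleAlgebra {
  act_bilin : bilin act;
  act1 : forall a, act 1 a = a;
  actM : forall h a b,
    act h (a * b) = \tsum_(h1, h2 <- Δ h) act h1 a * act h2 b;
  actA : forall h k a, act h (act k a) = act (h * k) a;
  act_unit : forall h, act h 1 = act (εt h) 1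
}.

Record is_comodule_coalgebra (K : fieldType) (A : weakBialgType K)
    (H : coalgType K) (rho : {linear H -> (H ⊗ A)%type}) : Prop :=
    IsComoduleCoalgebra {
  coact_counit : forall h, \tsum_(h0, h1 <- rho h) ε h1 *: h0 = h;
  coact_comul : forall h,
    \tsum_(h0, a <- rho h) \tsum_(h01, h02 <- Δ h0) h01 ⊗ h02 ⊗ a =
    \tsum_(h1, h2 <- Δ h) \tsum_(h10, h11 <- rho h1) \tsum_(h20, h21 <- rho h2)
      h10 ⊗ h20 ⊗ (h11 * h21);
  coactA : forall h,
    \tsum_(h0, a <- rho h) \tsum_(h00, h01 <- rho h0) h00 ⊗ h01 ⊗ a =
    \tsum_(h0, a <- rho h) \tsum_(a1, a2 <- Δ a) h0 ⊗ a1 ⊗ a2;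
  counit_coact : forall h,
    \tsum_(h0, h1 <- rho h) ε h0 *: h1 = \tsum_(h0, h1 <- rho h) ε h0 *: εs h1
}.

Section MatchedPair.
Variables (K : fieldType) (H A : weakBialgType K).
Variables (act : H -> A -> A) (rho : {linear H -> (H ⊗ A)%type}).

Local Notation "h · x" := (act h x) (at level 38, right associativity).

(* In the variable names below, a final [0] or [1] after the Sweedler index [i]
   of [hi] denotes the legs of [rho hi]; [u], [v] are the legs of [Δ 1] in [H]. *)
Record is_weak_matched_pair : Prop := IsWeakMatchedPair {
  wmp_module : is_module_algebra act;
  wmp_comodule : is_comodule_coalgebra rho;
  wmp_comul_act : forall (h g : H) (x : A),
    \tsum_(h1, h2 <- Δ h)
    \tsum_(p0, p1 <- rho (h2 * g))
    \tsum_(y1, y2 <- Δ (h1 · x))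
      p0 ⊗ y1 ⊗ (y2 * p1) =
    \tsum_(h1, h' <- Δ h) \tsum_(h2, h'' <- Δ h') \tsum_(h3, h4 <- Δ h'')
    \tsum_(g0, g1 <- rho g)
    \tsum_(x1, x2 <- Δ x)
    \tsum_(h10, h11 <- rho h1) \tsum_(h30, h31 <- rho h3)
      (h30 * g0) ⊗ (h10 · x1) ⊗ (h11 * (h2 · x2) * h31 * (h4 · g1));
  wmp_eps_s_act : forall (h : H) (x : A), εs (h · x) = εs (h · 1) * εs x;
  wmp_coact_unit :
    \tsum_(u, v <- Δ (1 : H)) rho u ⊗ v =
    \tsum_(u, v <- Δ (1 : H)) \tsum_(u', v' <- Δ (1 : H))
    \tsum_(u'0, u'1 <- rho u')
      u ⊗ (ε u'0 *: u'1) ⊗ (v * v')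
}.

Definition is_abelian_pair : Prop :=
  cocommutative H /\ commutative (@GRing.mul A).

Record is_compatible_pair : Prop := IsCompatiblePair {
  cwmp_matched : is_weak_matched_pair;
  cwmp_abelian : is_abelian_pair;
  cwmp_act_unit : forall h : H,
    h · 1 = \tsum_(h1, h2 <- Δ h) \tsum_(a1, a2 <- Δ (1 : A))
              ε (h2 · a2) *: (h1 · a1);
  cwmp_act_comul1 : forall h g : H,
    \tsum_(a1, a2 <- Δ (1 : A)) (h · a1) ⊗ (g · a2) =
    \tsum_(a1, a2 <- Δ (1 : A)) ((h · 1) * a1) ⊗ ((g · 1) * a2)
}.

Definition smash_mul (z w : (A ⊗ H)%type) : (A ⊗ H)%type :=
  \tsum_(x, h <- z) \tsum_(y, g <- w) \tsum_(h1, h2 <- Δ h)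
    (x * (h1 · y)) ⊗ (h2 * g).

Definition smash_comul (z : (A ⊗ H)%type) : ((A ⊗ H) ⊗ (A ⊗ H))%type :=
  \tsum_(x, h <- z) \tsum_(x1, x2 <- Δ x)
  \tsum_(h1, h2 <- Δ h) \tsum_(h10, h11 <- rho h1)
    (x1 ⊗ h10) ⊗ ((x2 * h11) ⊗ h2).

Definition smash_counit (z : (A ⊗ H)%type) : K :=
  \tsum_(x, h <- z) ε x * ε h.

Definition smash_under (z : (A ⊗ H)%type) : (A ⊗ H)%type :=
  smash_mul z (1 ⊗ 1).

Definition smash_underover (z : (A ⊗ H)%type) : (A ⊗ H)%type :=
  \tsum_(z1, z2 <- smash_comul (smash_under z)) smash_counit z2 *: z1.

End MatchedPair.

(* [is_smash act rho i sm] says that the weak Hopf algebra [W] is the image of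
   [smash_underover] with the structure induced from [A] and [H]: [i] is the
   inclusion of [W] into [A ⊗ H], and [sm x h] is the element of [W] whose
   inclusion is the image of [x ⊗ h].  As the elements [sm x h] span [W], the
   last five fields determine the whole structure of [W]. *)
Record is_smash (K : fieldType) (H A : weakHopfType K)
    (act : H -> A -> A) (rho : {linear H -> (H ⊗ A)%type})
    (W : weakHopfType K) (i : {linear W -> (A ⊗ H)%type}) (sm : A -> H -> W) :
    Prop := IsSmash {
  smash_inj : injective i;
  smash_image : forall z : (A ⊗ H)%type,
    (exists w, i w = z) <-> (exists z', z = smash_underover act rho z');
  smashE : forall x h, i (sm x h) = smash_underover act rho (x ⊗ h);
  smashM : forall x h y g,
    sm x h * sm y g = \tsum_(h1, h2 <- Δ h) sm (x * act h1 y) (h2 * g);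
  smash1 : 1 = sm 1 1;
  smash_comulE : forall x h,
    Δ (sm x h) =
    \tsum_(x1, x2 <- Δ x) \tsum_(h1, h2 <- Δ h) \tsum_(h10, h11 <- rho h1)
      sm x1 h10 ⊗ sm (x2 * h11) h2;
  smash_counitE : forall x h,
    ε (sm x h) =
    \tsum_(h1, h2 <- Δ h) \tsum_(h10, h11 <- rho h1)
      ε (x * act h10 1 * h11 * act h2 1) :> K;
  smash_antipodeE : forall x h,
    antipode (sm x h) =
    \tsum_(h0, h1 <- rho h) sm 1 (antipode h0) * sm (antipode (x * h1)) 1
}.

(* Main.v *)
(** Write [h · a] for [act h a] and [θ h] for the sum of the [ε h^0 *: h^1].  Set
    [e], the sum of the [θ u * (v · 1)] with [Δ 1 = u ⊗ v], and [η h], the sum of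
    the [(h_1^0 · 1) h_1^1 (h_2 · 1)].  As [t] is an integral and elements of
    [H_t] act by multiplication, [(x # h)(α # t) = x (h · α) # t].  The coaction
    of the unit gives [Δ (x # 1)] in terms of [Δ x], [Δ 1] and [e]; since [e] is
    idempotent, multiplying by [e] is invisible in [A # H], and one finds
    [εt (x # h) (α # t) = x (η h) α # t].

    The two sides agree because [h_1^0 ⊗ h_2 ⊗ εs h_1^1] equals
    [(h^0)_1 ⊗ (h^0)_2 ⊗ εs h^1], so that [(η h) α] is the sum of the
    [(h^0 · 1) (εs h^1) α], while the condition relating [α] and [t] replaces
    [h · α] by the same expression in front of [# t]. *)

Require Import Defs.
From HB Require Import structures.
From mathcomp Require Import all_boot all_algebra.

Set Implicit Arguments.
Unset Strict Implicit.
Unset Printing Implicit Defensive.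

Import GRing.Theory.
Local Open Scope ring_scope.

(** * Linear and multilinear maps, and their passage through Sweedler sums *)

Section Linearity.
Variable K : fieldType.
Implicit Types U V W X Y : lmodType K.

Definition trilin U V X W (f : U -> V -> X -> W) : Prop :=
  (forall c, bilin (fun a b => f a b c)) /\ (forall a b, linear (f a b)).

Lemma eq_tsum U V (W : nmodType) (t : (U ⊗ V)%type) (f g : U -> V -> W) :
  (forall a b, f a b = g a b) -> tsum t f = tsum t g.
Proof. by move=> fg; apply: eq_bigr. Qed.

Lemma exchange_tsum U V X Y (W : nmodType) (s : (U ⊗ V)%type)
    (t : (X ⊗ Y)%type) (f : U -> V -> X -> Y -> W) :
  \tsum_(a, b <- s) \tsum_(c, d <- t) f a b c d =
  \tsum_(c, d <- t) \tsum_(a, b <- s) f a b c d.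
Proof. exact: exchange_big. Qed.

Lemma linear_idfun U : linear (fun x : U => x).
Proof. by []. Qed.

Lemma linear_comp_struct U V W (f : {linear V -> W}) (g : U -> V) :
  linear g -> linear (fun x => f (g x)).
Proof. by move=> gl c x y; rewrite gl linearP. Qed.

Lemma linear_comp U V W (f : V -> W) (g : U -> V) :
  linear f -> linear g -> linear (fun x => f (g x)).
Proof. by move=> fl gl c x y; rewrite gl fl. Qed.

Lemma bilin_l U V W Y (f : U -> V -> W) (g : Y -> U) v :
  bilin f -> linear g -> linear (fun x => f (g x) v).
Proof. by move=> [fl _] gl c x y; rewrite gl fl. Qed.

Lemma bilin_r U V W Y (f : U -> V -> W) (g : Y -> V) u :
  bilin f -> linear g -> linear (fun x => f u (g x)).
Proof. by move=> [_ fr] gl c x y; rewrite gl fr. Qed.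

Lemma trilin_1 U V X W Y (f : U -> V -> X -> W) (g : Y -> U) b c :
  trilin f -> linear g -> linear (fun x => f (g x) b c).
Proof. by move=> [ft _]; apply: (bilin_l (f := fun a b => f a b c)). Qed.

Lemma trilin_2 U V X W Y (f : U -> V -> X -> W) (g : Y -> V) a c :
  trilin f -> linear g -> linear (fun x => f a (g x) c).
Proof. by move=> [ft _]; apply: (bilin_r (f := fun a b => f a b c)). Qed.

Lemma trilin_3 U V X W Y (f : U -> V -> X -> W) (g : Y -> X) a b :
  trilin f -> linear g -> linear (fun x => f a b (g x)).
Proof. by move=> [_ ft] gl c x y; rewrite gl ft. Qed.

Lemma linear_tsum_body U V W X (t : (U ⊗ V)%type) (f : X -> U -> V -> W) :
  (forall a b, linear (fun x => f x a b)) -> linear (fun x => tsum t (f x)).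
Proof.
move=> fl c x y; rewrite /tsum /eval_sum scaler_sumr -big_split.
by apply: eq_bigr => p _; rewrite /= fl.
Qed.

Lemma linear_tsum_arg U V W X (g : X -> (U ⊗ V)%type) (f : U -> V -> W) :
  bilin f -> linear g -> linear (fun x => tsum (g x) f).
Proof. by move=> bf; apply: (linear_comp (tsum_linear bf)). Qed.

Lemma linear_scale_r U W c (g : U -> W) :
  linear g -> linear (fun x => c *: g x).
Proof. by move=> gl k x y; rewrite gl scalerDr !scalerA mulrC. Qed.

Lemma linear_counit_l U (C : coalgType K) W (g : U -> C) (w : W) :
  linear g -> linear (fun x => ε (g x) *: w).
Proof. by move=> gl c x y; rewrite gl linearP scalerDl scalerA. Qed.

Lemma linear_mul_l U (B : algType K) (g : U -> B) b :
  linear g -> linear (fun x => g x * b).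
Proof. by move=> gl c x y; rewrite gl mulrDl scalerAl. Qed.

Lemma linear_mul_r U (B : algType K) (g : U -> B) b :
  linear g -> linear (fun x => b * g x).
Proof. by move=> gl c x y; rewrite gl mulrDr scalerAr. Qed.

Lemma linear_tpure_l U V W (g : W -> U) (v : V) :
  linear g -> linear (fun x => g x ⊗ v).
Proof. exact: (bilin_l _ (@tpure_bilin K U V)). Qed.

Lemma linear_tpure_r U V W (g : W -> V) (u : U) :
  linear g -> linear (fun x => u ⊗ g x).
Proof. exact: (bilin_r _ (@tpure_bilin K U V)). Qed.

Lemma linear_fun0 U V (f : U -> V) : linear f -> f 0 = 0.
Proof.
by move=> fl; have := fl (-1) 0 0; rewrite addr0 scaler0 scaleN1r addNr.
Qed.

Lemma linear_funZ U V (f : U -> V) c x : linear f -> f (c *: x) = c *: f x.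
Proof. by move=> fl; have := fl c x 0; rewrite !addr0 (linear_fun0 fl) addr0. Qed.

Lemma tsum_map U V W X (f : W -> X) (t : (U ⊗ V)%type) (g : U -> V -> W) :
  linear f -> f (tsum t g) = \tsum_(a, b <- t) f (g a b).
Proof.
move=> fl; apply: (big_morph f); last exact: linear_fun0.
move=> x y.
by rewrite -[x in f (x + _)]scale1r fl scale1r.
Qed.

Lemma tsumZ U V W c (t : (U ⊗ V)%type) (f : U -> V -> W) :
  c *: tsum t f = \tsum_(a, b <- t) c *: f a b.
Proof. exact: scaler_sumr. Qed.

Lemma tsum_nest U V W X Y (s : (U ⊗ V)%type) (g : U -> V -> (X ⊗ Y)%type)
    (f : X -> Y -> W) :
  bilin f -> tsum (tsum s g) f = \tsum_(a, b <- s) tsum (g a b) f.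
Proof. by move=> bf; apply: tsum_map (tsum_linear bf). Qed.

Lemma tsum_tpure U V (t : (U ⊗ V)%type) : tsum t tpure = t.
Proof.
apply: tensor_ext => W f bf; rewrite tsum_nest //; apply: eq_tsum => a b.
exact: tsum_pure.
Qed.

Lemma linear_eps_t (B : weakBialgType K) U (g : U -> B) :
  linear g -> linear (fun x => εt (g x)).
Proof.
move=> gl; apply: linear_tsum_body => a b.
exact/linear_counit_l/linear_mul_r.
Qed.

Lemma linear_eps_s (B : weakBialgType K) U (g : U -> B) :
  linear g -> linear (fun x => εs (g x)).
Proof.
move=> gl; apply: linear_tsum_body => a b.
exact/linear_counit_l/linear_mul_l.
Qed.

End Linearity.

(** Linearity in one variable is found by descending through the term to the argument that contains
    it; multilinear goals split into one such search per variable. *)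
Ltac lin :=
  lazymatch goal with
  | |- bilin _ => split=> ?; cbv beta; lin
  | |- trilin _ => split=> [?|? ?]; cbv beta; lin
  | |- GRing.linear_for _ (fun x => x) => exact: linear_idfun
  | |- GRing.linear_for _ (fun x => tsum _ _) =>
      first [ refine (linear_tsum_body _ _) => ? ?
            | refine (linear_tsum_arg _ _) ]; lin
  | |- GRing.linear_for _ (fun x => _ * _) =>
      first [ refine (linear_mul_l _ _) | refine (linear_mul_r _ _) ]; lin
  | |- GRing.linear_for _ (fun x => _ *: _) =>
      first [ refine (linear_scale_r _ _) | refine (linear_counit_l _ _) ]; lin
  | |- GRing.linear_for _ (fun x => _ ⊗ _) =>
      first [ refine (linear_tpure_l _ _) | refine (linear_tpure_r _ _) ]; lin
  | |- GRing.linear_for _ (fun x => eps_t _) => refine (linear_eps_t _); lin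
  | |- GRing.linear_for _ (fun x => eps_s _) => refine (linear_eps_s _); lin
  | |- GRing.linear_for _ (fun x => _) =>
      match goal with
      | H : bilin ?f |- GRing.linear_for _ (fun x => ?f _ _) =>
          first [refine (bilin_l _ H _) | refine (bilin_r _ H _)]; lin
      | H : trilin ?f |- GRing.linear_for _ (fun x => ?f _ _ _) =>
          first [ refine (trilin_1 _ _ H _) | refine (trilin_2 _ _ H _)
                | refine (trilin_3 _ _ H _) ]; lin
      | H : GRing.linear_for _ ?f |- GRing.linear_for _ (fun x => ?f _) =>
          refine (linear_comp H _); lin
      | _ => refine (linear_comp_struct _ _); lin
      end
  | |- GRing.linear_for _ id => exact: linear_idfun
  (* unification may have eta-contracted the function *)
  | |- GRing.linear_for ?s ?f =>
      first [assumption | exact: linearP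
            | change (GRing.linear_for s (fun x => f x)); lin]
  | |- _ => assumption
  end.

(** * Evaluation of trilinear maps on triple tensors *)

Section Evaluation.
Variables (K : fieldType) (U V X W : lmodType K).

(** Applied to both sides of an axiom stated in a triple tensor product, this map turns it into an
    identity for an arbitrary trilinear map, usable inside larger sums. *)
Definition tsum3 (f : U -> V -> X -> W) (t : (U ⊗ V ⊗ X)%type) : W :=
  \tsum_(p, c <- t) \tsum_(a, b <- p) f a b c.

Lemma tsum3_bilin (f : U -> V -> X -> W) : trilin f ->
  bilin (fun (p : (U ⊗ V)%type) c => \tsum_(a, b <- p) f a b c).
Proof. by move=> ft; lin. Qed.

Lemma tsum3_linear (f : U -> V -> X -> W) : trilin f -> linear (tsum3 f).
Proof. by move=> ft; exact: tsum_linear (tsum3_bilin ft). Qed.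

Lemma tsum3_tpure (f : U -> V -> X -> W) p c : trilin f ->
  tsum3 f (p ⊗ c) = \tsum_(a, b <- p) f a b c.
Proof. by move=> ft; exact: tsum_pure (tsum3_bilin ft) _ _. Qed.

Lemma tsum3_tpure2 (f : U -> V -> X -> W) a b c : trilin f ->
  tsum3 f (a ⊗ b ⊗ c) = f a b c.
Proof.
move=> ft; rewrite tsum3_tpure //.
by have [fb _] := ft; rewrite tsum_pure.
Qed.

Lemma tsum3_tsum (f : U -> V -> X -> W) (Y Z : lmodType K) (s : (Y ⊗ Z)%type) g :
  trilin f -> tsum3 f (tsum s g) = \tsum_(a, b <- s) tsum3 f (g a b).
Proof. by move=> ft; apply: tsum_map (tsum3_linear ft). Qed.

End Evaluation.

Ltac ev3 :=
  lazymatch goal with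
  | |- tsum3 _ (tsum _ _) = _ =>
      rewrite (tsum3_tsum _ _ ltac:(eassumption)); apply: eq_tsum => ? ?; ev3
  | |- tsum3 _ (tpure (tpure _ _) _) = _ => exact: tsum3_tpure2
  | |- tsum3 _ (tpure _ _) = _ => exact: tsum3_tpure
  end.

(** * Coalgebra axioms in evaluated form *)

Section Coalgebras.
Variables (K : fieldType) (C : coalgType K) (W : lmodType K).

Lemma coassocE h (f : C -> C -> C -> W) : trilin f ->
  \tsum_(a, b <- Δ h) \tsum_(a1, a2 <- Δ a) f a1 a2 b =
  \tsum_(a, b <- Δ h) \tsum_(b1, b2 <- Δ b) f a b1 b2.
Proof.
move=> ft; have E := congr1 (tsum3 f) (coassoc h).
by etransitivity; [|etransitivity; [exact: E|]]; first symmetry; ev3.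
Qed.

Lemma counitlE h (f : C -> W) : linear f ->
  \tsum_(a, b <- Δ h) ε a *: f b = f h.
Proof.
move=> fl; rewrite -[in RHS](counitl h) tsum_map //; apply: eq_tsum => a b.
by rewrite (linear_funZ _ _ fl).
Qed.

Lemma counitrE h (f : C -> W) : linear f ->
  \tsum_(a, b <- Δ h) ε b *: f a = f h.
Proof.
move=> fl; rewrite -[in RHS](counitr h) tsum_map //; apply: eq_tsum => a b.
by rewrite (linear_funZ _ _ fl).
Qed.

Lemma cocommE h (f : C -> C -> W) : cocommutative C -> bilin f ->
  tsum (Δ h) f = \tsum_(a, b <- Δ h) f b a.
Proof.
move=> cc bf; rewrite [in LHS]cc tsum_nest //; apply: eq_tsum => a b.
exact: tsum_pure.
Qed.

End Coalgebras.

(** * Weak bialgebras and their counital maps *)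

Section WeakBialgebras.
Variables (K : fieldType) (B : weakBialgType K) (W : lmodType K).
Implicit Types (a b h k x y : B).

Lemma comulME h k (f : B -> B -> W) : bilin f ->
  tsum (Δ (h * k)) f =
  \tsum_(h1, h2 <- Δ h) \tsum_(k1, k2 <- Δ k) f (h1 * k1) (h2 * k2).
Proof.
move=> bf; rewrite comulM tsum_nest //; apply: eq_tsum => h1 h2.
by rewrite tsum_nest //; apply: eq_tsum => k1 k2; exact: tsum_pure.
Qed.

Lemma comul1_12E (f : B -> B -> B -> W) : trilin f ->
  \tsum_(a, b <- Δ 1) \tsum_(a', b' <- Δ 1) f a' (a * b') b =
  \tsum_(a, b <- Δ 1) \tsum_(a1, a2 <- Δ a) f a1 a2 b.
Proof.
move=> ft; have E := congr1 (tsum3 f) (comul1_12 (s := B)).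
by etransitivity; [|etransitivity; [exact: E|]]; first symmetry; ev3.
Qed.

Lemma comul1_21E (f : B -> B -> B -> W) : trilin f ->
  \tsum_(a, b <- Δ 1) \tsum_(a', b' <- Δ 1) f a (b * a') b' =
  \tsum_(a, b <- Δ 1) \tsum_(a1, a2 <- Δ a) f a1 a2 b.
Proof.
move=> ft; have E := congr1 (tsum3 f) (comul1_21 (s := B)).
by etransitivity; [|etransitivity; [exact: E|]]; first symmetry; ev3.
Qed.

Lemma counitM12E h k l (w : W) :
  \tsum_(k1, k2 <- Δ k) ε (h * k1) *: (ε (k2 * l) *: w) =
  ε (h * k * l) *: w.
Proof.
rewrite counitM12 /tsum /eval_sum scaler_suml.
by apply: eq_bigr => p _; rewrite scalerA.
Qed.

Lemma counitM21E h k l (w : W) :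
  \tsum_(k1, k2 <- Δ k) ε (h * k2) *: (ε (k1 * l) *: w) =
  ε (h * k * l) *: w.
Proof.
rewrite counitM21 /tsum /eval_sum scaler_suml.
by apply: eq_bigr => p _; rewrite scalerA.
Qed.

Lemma eps_tE h (f : B -> W) : linear f ->
  f (εt h) = \tsum_(a, b <- Δ 1) ε (a * h) *: f b.
Proof.
move=> fl; rewrite /eps_t tsum_map //; apply: eq_tsum => a b.
exact: linear_funZ.
Qed.

Lemma eps_sE h (f : B -> W) : linear f ->
  f (εs h) = \tsum_(a, b <- Δ 1) ε (h * b) *: f a.
Proof.
move=> fl; rewrite /eps_s tsum_map //; apply: eq_tsum => a b.
exact: linear_funZ.
Qed.

(** Coassociativity exhibits the double coproduct of the unit, which a unit axiom rewrites with two
    copies of [Δ 1]; one copy then sums to [εt k]. The order of the factors in the chosen axiom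
    decides on which side [εt k] appears. *)
Lemma comul_eps_t_r k (f : B -> B -> W) : bilin f ->
  tsum (Δ (εt k)) f = \tsum_(a, b <- Δ 1) f (εt k * a) b.
Proof.
move=> bf.
transitivity (\tsum_(u, v <- Δ (1 : B)) \tsum_(a, b <- Δ v)
  ε (u * k) *: f a b).
  rewrite (@eps_tE k (fun x => tsum (Δ x) f)); last by lin.
  by apply: eq_tsum => u v; rewrite tsumZ.
rewrite -(coassocE _ (f := fun u a b => ε (u * k) *: f a b)); last by lin.
rewrite -(comul1_21E (f := fun u a b => ε (u * k) *: f a b)); last by lin.
rewrite exchange_tsum; apply: eq_tsum => a b.
by rewrite (@eps_tE k (fun x => f (x * a) b)) //; lin.
Qed.

Lemma comul_eps_t_l k (f : B -> B -> W) : bilin f ->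
  tsum (Δ (εt k)) f = \tsum_(a, b <- Δ 1) f (a * εt k) b.
Proof.
move=> bf.
transitivity (\tsum_(u, v <- Δ (1 : B)) \tsum_(a, b <- Δ v)
  ε (u * k) *: f a b).
  rewrite (@eps_tE k (fun x => tsum (Δ x) f)); last by lin.
  by apply: eq_tsum => u v; rewrite tsumZ.
rewrite -(coassocE _ (f := fun u a b => ε (u * k) *: f a b)); last by lin.
rewrite -(comul1_12E (f := fun u a b => ε (u * k) *: f a b)); last by lin.
apply: eq_tsum => a b.
by rewrite (@eps_tE k (fun x => f (a * x) b)) //; lin.
Qed.

Lemma comul_eps_s k (f : B -> B -> W) : bilin f ->
  tsum (Δ (εs k)) f = \tsum_(a, b <- Δ 1) f a (εs k * b).
Proof.
move=> bf.
transitivity (\tsum_(u, v <- Δ (1 : B)) \tsum_(a, b <- Δ u)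
  ε (k * v) *: f a b).
  rewrite (@eps_sE k (fun x => tsum (Δ x) f)); last by lin.
  by apply: eq_tsum => u v; rewrite tsumZ.
rewrite -(comul1_12E (f := fun a b v => ε (k * v) *: f a b)); last by lin.
rewrite exchange_tsum; apply: eq_tsum => a b.
by rewrite (@eps_sE k (fun x => f a (x * b))) //; lin.
Qed.

(** Contract the middle leg of [comul1_12] with [ε]: one side becomes [εt] on the second leg, the
    other collapses by the counit. Second legs can thus be treated as target elements. *)
Lemma comul1_eps_t (f : B -> B -> W) : bilin f ->
  \tsum_(u, v <- Δ 1) f u (εt v) = tsum (Δ 1) f.
Proof.
move=> bf.
transitivity (\tsum_(a, b <- Δ (1 : B)) \tsum_(a', b' <- Δ (1 : B))
  ε (a * b') *: f a' b).
  rewrite exchange_tsum; apply: eq_tsum => u v.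
  by rewrite (@eps_tE v (fun x => f u x)) //; lin.
rewrite (comul1_12E (f := fun a b c => ε b *: f a c)); last by lin.
by apply: eq_tsum => a b; rewrite (@counitrE _ _ _ a (fun x => f x b)) //; lin.
Qed.

Lemma comul1_eps_s (f : B -> B -> W) : bilin f ->
  \tsum_(u, v <- Δ 1) f (εs u) v = tsum (Δ 1) f.
Proof.
move=> bf.
transitivity (\tsum_(a, b <- Δ (1 : B)) \tsum_(a', b' <- Δ (1 : B))
  ε (a' * b) *: f a b').
  rewrite exchange_tsum; apply: eq_tsum => u v.
  by rewrite (@eps_sE u (fun x => f x v)) //; lin.
rewrite exchange_tsum.
rewrite (comul1_12E (f := fun a b c => ε b *: f a c)); last by lin.
by apply: eq_tsum => a b; rewrite (@counitrE _ _ _ a (fun x => f x b)) //; lin.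
Qed.

(** Writing [h] as [1 * h] absorbs the copy of [Δ 1] left by [comul_eps_t_r]. *)
Lemma comul_eps_tM k h (f : B -> B -> W) : bilin f ->
  tsum (Δ (εt k * h)) f = \tsum_(h1, h2 <- Δ h) f (εt k * h1) h2.
Proof.
move=> bf; rewrite comulME //.
rewrite (@comul_eps_t_r k
  (fun a b => \tsum_(h1, h2 <- Δ h) f (a * h1) (b * h2))); last by lin.
rewrite -[in RHS](mul1r h) comulME; last by lin.
by apply: eq_tsum => a b; apply: eq_tsum => h1 h2; rewrite mulrA.
Qed.

(** Write [x] as [x * 1]. Weak multiplicativity splits [ε (x1 * u * y)] over a further coproduct,
    and the factor at [x1] is then removed by the counit axiom. *)
Lemma counit_comul_l x y (f : B -> W) : linear f ->
  \tsum_(x1, x2 <- Δ x) ε (x1 * y) *: f x2 = f (x * εt y).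
Proof.
move=> fl.
transitivity (\tsum_(u, v <- Δ (1 : B))
   \tsum_(x1, x2 <- Δ (x * v)) ε x1 *: (ε (u * y) *: f x2)).
  rewrite -[in LHS](mulr1 x) comulME; last by lin.
  under [in RHS]eq_tsum => u v do (rewrite comulME; last by lin).
  rewrite [RHS]exchange_tsum; apply: eq_tsum => x1 x2.
  rewrite -(coassocE _ (f := fun u v1 v2 =>
    ε (x1 * v1) *: (ε (u * y) *: f (x2 * v2)))); last by lin.
  by apply: eq_tsum => u v; rewrite counitM21E.
rewrite (@eps_tE y (fun z => f (x * z))); last by lin.
apply: eq_tsum => u v.
by rewrite (@counitlE _ _ _ _ (fun z => ε (u * y) *: f z)) //; lin.
Qed.

(** Mirror image of [counit_comul_l]; commutativity turns the leftover [ε (v * y)] into the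
    [ε (y * v)] of [εs]. *)
Lemma counit_comul_r x y (f : B -> W) : commutative (@GRing.mul B) ->
  linear f ->
  \tsum_(x1, x2 <- Δ x) ε (x2 * y) *: f x1 = f (x * εs y).
Proof.
move=> mC fl.
transitivity (\tsum_(u, v <- Δ (1 : B))
   \tsum_(x1, x2 <- Δ (x * u)) ε x2 *: (ε (v * y) *: f x1)).
  rewrite -[in LHS](mulr1 x) comulME; last by lin.
  under [in RHS]eq_tsum => u v do (rewrite comulME; last by lin).
  rewrite [RHS]exchange_tsum; apply: eq_tsum => x1 x2.
  rewrite (coassocE _ (f := fun u1 u2 v =>
    ε (x2 * u2) *: (ε (v * y) *: f (x1 * u1)))); last by lin.
  by apply: eq_tsum => u v; rewrite counitM12E.
rewrite (@eps_sE y (fun z => f (x * z))); last by lin.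
apply: eq_tsum => u v; rewrite [v * y]mC.
by rewrite (@counitrE _ _ _ _ (fun z => ε (y * v) *: f z)) //; lin.
Qed.

End WeakBialgebras.

(** * Counital maps in the commutative case *)

Section CommutativeWeakBialgebras.
Variables (K : fieldType) (B : weakBialgType K).
Hypothesis mC : commutative (@GRing.mul B).
Implicit Types (a b h k x y : B).

(** By commutativity [ε (x * b)] is [ε (b * x)], so the two counits recombine across [Δ 1] by weak
    multiplicativity. *)
Lemma eps_t_eps_s x : εt (εs x) = εt x.
Proof.
apply: eq_tsum => u v.
have cl : linear (fun z : B => ε (u * z) *: v) by lin.
rewrite (eps_sE _ cl); transitivity (ε (u * 1 * x) *: v); last by rewrite mulr1.
rewrite -counitM12E; apply: eq_tsum => a b.
by rewrite [b * x]mC scalerA mulrC -scalerA.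
Qed.

Lemma eps_s_epsM x y : εs (εs x * y) = εs (x * y).
Proof.
apply: eq_tsum => u v.
have cl : linear (fun z : B => ε (z * y * v) *: u) by lin.
rewrite (eps_sE _ cl).
transitivity (ε (x * 1 * (y * v)) *: u); last by rewrite mulr1 mulrA.
by rewrite -counitM21E; apply: eq_tsum => a b; rewrite mulrA.
Qed.

(** The product on the right is the coproduct of [εs x] with its second leg contracted against [y],
    and that coproduct is [Δ 1] with [εs x] on the second leg. *)
Lemma eps_sM x y : εs (x * y) = εs x * εs y.
Proof.
rewrite -eps_s_epsM.
have idl := @linear_idfun K B.
rewrite -(counit_comul_r _ _ mC idl) comul_eps_s; last by lin.
by apply: eq_tsum => u v; rewrite -!mulrA [y * v]mC.
Qed.

End CommutativeWeakBialgebras.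

(** Together with [comul1_eps_t], this places both legs of [Δ 1] among the target elements, which
    act by multiplication. *)
Lemma comul1_eps_t_l (K : fieldType) (B : weakBialgType K) (W : lmodType K)
    (f : B -> B -> W) : cocommutative B -> bilin f ->
  \tsum_(u, v <- Δ 1) f (εt u) v = tsum (Δ 1) f.
Proof.
move=> cc bf; rewrite cocommE //; last by lin.
rewrite (comul1_eps_t (f := fun u v => f v u)); last by lin.
by rewrite [RHS]cocommE.
Qed.

(** * Antipode and integrals against the counital maps *)

Section CommutativeWeakHopf.
Variables (K : fieldType) (B : weakHopfType K).

(** Contract [antipode h1 * h2] first. On the coproduct of [εs x] this only puts [εs] on a first leg
    of [Δ 1], where it is absorbed, and [h1 * antipode h2] remains. *)
Lemma antipode_eps_s (x : B) : antipode (εs x) = εt (εs x) :> B.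
Proof.
have trl : trilin (fun a b c : B => antipode a * b * antipode c) by lin.
rewrite -[LHS]antipodeLR -coassocE //.
under eq_tsum => h1 h2.
  rewrite -(@tsum_map _ _ _ _ _ (fun z => z * antipode h2)); last by lin.
  rewrite antipodeL; over.
rewrite comul_eps_s; last by lin.
rewrite (@comul1_eps_s _ _ _ (fun u v => u * antipode (εs x * v))); last by lin.
by rewrite -antipodeR comul_eps_s //; lin.
Qed.

(** An integral sees only [εt], which does not distinguish [x] from [εs x]. *)
Lemma left_integral_eps_s (a x : B) : commutative (@GRing.mul B) ->
  left_integral a -> εs x * a = x * a.
Proof. by move=> mC int_a; rewrite [LHS]int_a (eps_t_eps_s mC) -int_a. Qed.

End CommutativeWeakHopf.

(** * Target elements acting on a module algebra *)

Section ModuleAlgebra.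
Variables (K : fieldType) (H : weakBialgType K) (A : algType K).
Variable act : H -> A -> A.
Hypothesis actP : is_module_algebra act.

Let act_bl : bilin act := act_bilin actP.

(** In the action on [1 * x], the factor [εt k] can be placed on the first leg of [Δ 1], next to the
    unit; what remains is the action of [1] on a product. *)
Lemma act_eps_t k x : act (εt k) x = act (εt k) 1 * x.
Proof.
rewrite -[in LHS](mul1r x) (actM actP) comul_eps_t_l; last by lin.
rewrite -[RHS](act1 actP) (actM actP); apply: eq_tsum => a b.
by rewrite (actA actP).
Qed.

Lemma act_eps_tM1 k h : act (εt k * h) 1 = act (εt k) 1 * act h 1.
Proof. by rewrite -(actA actP) act_eps_t. Qed.

Lemma act_mul1 h a : \tsum_(h1, h2 <- Δ h) act h1 a * act h2 1 = act h a.
Proof. by rewrite -(actM actP) mulr1. Qed.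

End ModuleAlgebra.

(** * Coaction against comultiplication *)

Section ComoduleCoalgebra.
Variables (K : fieldType) (A : weakBialgType K) (H : coalgType K).
Variables (rho : {linear H -> (H ⊗ A)%type}) (W : lmodType K).
Hypothesis rhoP : is_comodule_coalgebra rho.

Lemma coact_comulE h (f : H -> H -> A -> W) : trilin f ->
  \tsum_(h0, a <- rho h) \tsum_(h01, h02 <- Δ h0) f h01 h02 a =
  \tsum_(h1, h2 <- Δ h) \tsum_(h10, h11 <- rho h1) \tsum_(h20, h21 <- rho h2)
    f h10 h20 (h11 * h21).
Proof.
move=> ft; have E := congr1 (tsum3 f) (coact_comul rhoP h).
by etransitivity; [|etransitivity; [exact: E|]]; first symmetry; ev3.
Qed.

Lemma coactAE h (f : H -> A -> A -> W) : trilin f ->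
  \tsum_(h0, a <- rho h) \tsum_(h00, h01 <- rho h0) f h00 h01 a =
  \tsum_(h0, a <- rho h) \tsum_(a1, a2 <- Δ a) f h0 a1 a2.
Proof.
move=> ft; have E := congr1 (tsum3 f) (coactA rhoP h).
by etransitivity; [|etransitivity; [exact: E|]]; first symmetry; ev3.
Qed.

Lemma coact_counitE h (f : H -> W) : linear f ->
  \tsum_(h0, h1 <- rho h) ε h1 *: f h0 = f h.
Proof.
move=> fl; rewrite -[in RHS](coact_counit rhoP h) tsum_map //.
by apply: eq_tsum => a b; rewrite (linear_funZ _ _ fl).
Qed.

(* Both sides become [h_1^0 ⊗ h_2^0 ⊗ εs (h_1^1 h_2^1)] once [h] is replaced on
   the left by [ε h^1 *: h^0]. *)
Lemma eps_s_coact_comul h (f : H -> H -> A -> W) :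
  commutative (@GRing.mul A) -> trilin f ->
  \tsum_(h1, h2 <- Δ h) \tsum_(h10, h11 <- rho h1) f h10 h2 (εs h11) =
  \tsum_(h0, a <- rho h) \tsum_(h01, h02 <- Δ h0) f h01 h02 (εs a).
Proof.
move=> mC ft; rewrite coact_comulE; last by lin.
rewrite -[in LHS](coact_counitE h (f := fun h => \tsum_(h1, h2 <- Δ h)
  \tsum_(h10, h11 <- rho h1) f h10 h2 (εs h11))); last by lin.
under eq_tsum => h0 a do rewrite tsumZ.
rewrite (coact_comulE h (f := fun h01 h02 a =>
  ε a *: (\tsum_(h10, h11 <- rho h01) f h10 h02 (εs h11)))); last by lin.
apply: eq_tsum => h1 h2; rewrite exchange_tsum [RHS]exchange_tsum.
apply: eq_tsum => h20 h21.
under eq_tsum => h10 h11 do rewrite tsumZ.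
rewrite (coactAE h1 (f := fun h100 a1 a2 =>
  ε (a2 * h21) *: f h100 h20 (εs a1))); last by lin.
apply: eq_tsum => h10 h11.
rewrite (counit_comul_r (f := fun a => f h10 h20 (εs a)) _ _ mC); last by lin.
by rewrite [h11 * εs _]mC eps_s_epsM mC.
Qed.

End ComoduleCoalgebra.

(** Linearity makes [sm] bilinear and shows that the elements [sm x h] span [W]. *)
Lemma smash_underover_linear (K : fieldType) (H A : weakBialgType K)
    (act : H -> A -> A) (rho : {linear H -> (H ⊗ A)%type}) :
  bilin act -> linear (smash_underover act rho).
Proof.
move=> act_bl.
have mul_lin : bilin (smash_mul act) by rewrite /smash_mul; lin.
have comul_lin : linear (smash_comul rho) by rewrite /smash_comul; lin.
have bl : bilin (fun z1 z2 : (A ⊗ H)%type => smash_counit z2 *: z1).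
  split=> z c x y /=; first by rewrite scalerDr !scalerA mulrC.
  rewrite scalerA -scalerDl; congr (_ *: _).
  (* [K^o] is the field as a module over itself, so that the product of the two counits is a
     bilinear map in the required sense. *)
  have bk : bilin (fun (x : A) (h : H) => ε x * ε h : K^o).
    split=> w k u v /=; rewrite linearP /=.
      by rewrite mulrDl -mulrA.
    by rewrite mulrDr mulrCA.
  exact: (tsum_linear bk).
apply: (linear_tsum_arg bl); apply: (linear_comp comul_lin).
by apply: (bilin_l _ mul_lin); lin.
Qed.

(** * The idempotent [e] of a compatible matched pair *)

Section Smash.
Variables (K : fieldType) (H A : weakHopfType K).
Variables (act : H -> A -> A) (rho : {linear H -> (H ⊗ A)%type}).
Hypothesis compat : is_compatible_pair act rho.

Let actP : is_module_algebra act := wmp_module (cwmp_matched compat).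
Let rhoP : is_comodule_coalgebra rho := wmp_comodule (cwmp_matched compat).
Let act_bl : bilin act := act_bilin actP.
Let cc : cocommutative H := proj1 (cwmp_abelian compat).
Let mC : commutative (@GRing.mul A) := proj2 (cwmp_abelian compat).

Lemma mCA : @left_commutative A A *%R.
Proof. by move=> x y z; rewrite !mulrA [x * y]mC. Qed.

Lemma mAC : @right_commutative A A *%R.
Proof. by move=> x y z; rewrite -!mulrA [y * z]mC. Qed.

Definition coact_eps (h : H) : A := \tsum_(h0, h1 <- rho h) ε h0 *: h1.
Local Notation θ := coact_eps.

Let coact_eps_lin : linear θ.
Proof. by rewrite /coact_eps; lin. Qed.

(** The last comodule axiom makes [θ h] a combination of values of [εs]. This is what lets the
    antipode identities simplify on [θ u]. *)
Lemma eps_s_coact_eps h : εs (θ h) = θ h.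
Proof.
rewrite [RHS](counit_coact rhoP) /coact_eps (@tsum_map _ _ _ _ _ (fun x => εs x)); last by lin.
apply: eq_tsum => h0 h1.
by apply: (linear_funZ (f := fun x => εs x)); lin.
Qed.

Lemma coact_unitE (W : lmodType K) (f : H -> A -> H -> W) : trilin f ->
  \tsum_(u, v <- Δ 1) \tsum_(u0, u1 <- rho u) f u0 u1 v =
  \tsum_(u, v <- Δ 1) \tsum_(u', v' <- Δ 1) f u (θ u') (v * v').
Proof.
move=> ft; have E := congr1 (tsum3 f) (wmp_coact_unit (cwmp_matched compat)).
etransitivity; [|etransitivity; [exact: E|]]; first symmetry; first by ev3.
rewrite tsum3_tsum //; apply: eq_tsum => u v.
rewrite tsum3_tsum //; apply: eq_tsum => u' v'.
rewrite tsum3_tsum // [RHS](@tsum_map _ _ _ _ _ (fun x => f u x (v * v'))).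
  by apply: eq_tsum => u'0 u'1; rewrite tsum3_tpure2.
by lin.
Qed.

(** Apply [θ] to the first leg of the coaction of [u]. The coaction of the unit gives two copies of
    [Δ 1], while coassociativity of the coaction gives the coproduct of [θ u]. *)
Lemma coact_unit_comul (W : lmodType K) (f : A -> A -> H -> W) : trilin f ->
  \tsum_(u, v <- Δ 1) \tsum_(u', v' <- Δ 1) f (θ u) (θ u') (v * v') =
  \tsum_(u, v <- Δ 1) \tsum_(a, b <- Δ (θ u)) f a b v.
Proof.
move=> ft; rewrite -(coact_unitE (f := fun h a k => f (θ h) a k)); last by lin.
apply: eq_tsum => u v.
transitivity (\tsum_(u0, u1 <- rho u) \tsum_(u00, u01 <- rho u0)
    ε u00 *: f u01 u1 v).
  apply: eq_tsum => u0 u1.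
  rewrite {1}/coact_eps (@tsum_map _ _ _ _ _ (fun x => f x u1 v)); last by lin.
  apply: eq_tsum => u00 u01.
  by apply: (linear_funZ (f := fun x => f x u1 v)); lin.
rewrite (coactAE rhoP u (f := fun u0 a b => ε u0 *: f a b v)); last by lin.
rewrite /coact_eps (@tsum_map _ _ _ _ _ (fun x => tsum (Δ x) _)); last by lin.
apply: eq_tsum => u0 u1; rewrite -tsumZ; symmetry.
by apply: (linear_funZ (f := fun x => tsum (Δ x) (fun a b => f a b v))); lin.
Qed.

Definition smash_unit : A := \tsum_(u, v <- Δ 1) θ u * act v 1.
Local Notation e := smash_unit.

(** Replacing [v] by [εt v] makes the action on [1] multiplicative, after which [coact_unit_comul]
    merges the two copies of [Δ 1]. *)
Lemma smash_unit_mul_gen (f : A -> A -> A) : bilin f ->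
  \tsum_(u, v <- Δ 1) \tsum_(u', v' <- Δ 1)
     f (θ u) (θ u') * (act v 1 * act v' 1) =
  \tsum_(u, v <- Δ 1) tsum (Δ (θ u)) f * act v 1.
Proof.
move=> bf; transitivity (\tsum_(u, v <- Δ (1 : H)) \tsum_(u', v' <- Δ (1 : H))
   f (θ u) (θ u') * act (v * v') 1).
  rewrite -(@comul1_eps_t _ _ _ (fun u v => \tsum_(u', v' <- Δ (1 : H))
   f (θ u) (θ u') * (act v 1 * act v' 1))); last by lin.
  rewrite -[in RHS](@comul1_eps_t _ _ _ (fun u v => \tsum_(u', v' <- Δ (1 : H))
   f (θ u) (θ u') * act (v * v') 1)); last by lin.
  apply: eq_tsum => u v; apply: eq_tsum => u' v'.
  by rewrite act_eps_tM1.
rewrite (coact_unit_comul (f := fun a b v => f a b * act v 1)); last by lin.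
apply: eq_tsum => u v.
by rewrite (@tsum_map _ _ _ _ _ (fun x => x * act v 1)) //; lin.
Qed.

(** Elements shaped like [e] multiply by convolution of [f] and [g], which brings the antipode
    identities into play. *)
Lemma smash_unit_mul (f g : A -> A) : linear f -> linear g ->
  (\tsum_(u, v <- Δ 1) f (θ u) * act v 1) *
  (\tsum_(u, v <- Δ 1) g (θ u) * act v 1) =
  \tsum_(u, v <- Δ 1) (\tsum_(a, b <- Δ (θ u)) f a * g b) * act v 1.
Proof.
move=> fl gl; rewrite -smash_unit_mul_gen; last by lin.
rewrite (@tsum_map _ _ _ _ _ (fun x => x * _)); last by lin.
apply: eq_tsum => u v.
rewrite (@tsum_map _ _ _ _ _ (fun x => _ * x)); last by lin.
apply: eq_tsum => u' v'.
by rewrite -!mulrA [act v 1 * (g _ * _)]mCA.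
Qed.

(* [e'] is the image of [e] under the antipode; comparing [e' * e], computed from
   [S a_1 a_2 = εs a], with [e * e'], computed from [a_1 S a_2 = εt a], shows that
   [e' = e]. *)
Lemma smash_unit_idem : e * e = e.
Proof.
pose e' := \tsum_(u, v <- Δ 1) antipode (θ u) * act v 1.
have idl : linear (fun x : A => x) by lin.
have Sl : linear (fun x : A => antipode x) by lin.
have e'e : e' * e = e.
  rewrite /e' /smash_unit (smash_unit_mul Sl idl); apply: eq_tsum => u v.
  by rewrite antipodeL eps_s_coact_eps.
have ee' : e * e' = e'.
  rewrite /e' /smash_unit (smash_unit_mul idl Sl); apply: eq_tsum => u v.
  by rewrite antipodeR -[in LHS]eps_s_coact_eps -antipode_eps_s
    eps_s_coact_eps.
have ee : e = e' by rewrite -e'e mC ee'.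
by rewrite {1}ee e'e.
Qed.

(** * The weak Hopf algebra carried by the smash product *)

Section InducedWeakHopf.
Variables (W : weakHopfType K) (i : {linear W -> (A ⊗ H)%type}) (sm : A -> H -> W).
Hypothesis smashW : is_smash act rho i sm.

Lemma smash_bilin : bilin sm.
Proof.
have under_lin := smash_underover_linear rho act_bl.
split=> [h c x y|x c h k]; apply: (smash_inj smashW);
  rewrite linearP !(smashE smashW) -under_lin; congr smash_underover.
  by rewrite (proj1 (@tpure_bilin K A H)).
by rewrite (proj2 (@tpure_bilin K A H)).
Qed.

Let sm_bl := smash_bilin.

Lemma smash_act1 x h : \tsum_(h1, h2 <- Δ h) sm (x * act h1 1) h2 = sm x h.
Proof.
rewrite -[RHS]mulr1 (smash1 smashW) (smashM smashW).
by apply: eq_tsum => h1 h2; rewrite mulr1.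
Qed.

(** Both sides are expanded by the unit of [W]; a target factor stays on the first leg of the
    coproduct and acts there by multiplication. *)
Lemma smash_eps_tM x k h : sm x (εt k * h) = sm (x * act (εt k) 1) h.
Proof.
rewrite -smash_act1 comul_eps_tM; last by lin.
rewrite -[RHS]smash_act1; apply: eq_tsum => h1 h2.
by rewrite act_eps_tM1 // mulrA.
Qed.

Lemma smash_eps_t x k : sm x (εt k) = sm (x * act (εt k) 1) 1.
Proof. by rewrite -[εt k in LHS]mulr1 smash_eps_tM. Qed.

(** The second leg of [Δ 1] crosses over to [A] as a target element, where the two actions recombine
    into the action of [1] on [y]. *)
Lemma smash_mul1 a y g : sm a 1 * sm y g = sm (a * y) g.
Proof.
rewrite (smashM smashW) -(@comul1_eps_t _ _ _ (fun u v => sm _ (v * g)));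
  last by lin.
under eq_tsum => u v do rewrite smash_eps_tM.
rewrite (@comul1_eps_t _ _ _ (fun u v => sm (a * act u y * act v 1) g));
  last by lin.
rewrite -(@tsum_map _ _ _ _ _ (fun z => sm z g)); last by lin.
under eq_tsum => u v do rewrite -mulrA.
rewrite -(@tsum_map _ _ _ _ _ (fun z => a * z)); last by lin.
by rewrite act_mul1 // (act1 actP).
Qed.

(** The integral turns [h2] into [εt h2], which crosses over to [A] and completes the action of [h]
    on [a * 1]. *)
Lemma smash_mul_integral x h a t : left_integral t ->
  sm x h * sm a t = sm (x * act h a) t.
Proof.
move=> int_t; rewrite (smashM smashW).
under eq_tsum => h1 h2 do rewrite int_t smash_eps_tM -(act_unit actP) -mulrA.
rewrite -(@tsum_map _ _ _ _ _ (fun z => sm (x * z) t)); last by lin.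
by rewrite act_mul1.
Qed.

Definition smash_eta (h : H) : A :=
  \tsum_(h1, h2 <- Δ h) \tsum_(h10, h11 <- rho h1) act h10 1 * h11 * act h2 1.
Local Notation η := smash_eta.

Let smash_eta_lin : linear η.
Proof. by rewrite /smash_eta; lin. Qed.

Lemma smash_counit_eta x h : ε (sm x h) = ε (x * η h).
Proof.
rewrite (smash_counitE smashW) /smash_eta {2 4}/tsum /eval_sum.
rewrite mulr_sumr linear_sum; apply: eq_bigr => p _.
rewrite mulr_sumr linear_sum; apply: eq_bigr => q _.
by rewrite !mulrA.
Qed.

(** The coaction of the unit leaves only legs of [Δ 1] in [H]; being target elements, they all cross
    over to [A], where the second copy of [Δ 1] sums to [e]. *)
Lemma smash_comul1 (V : lmodType K) x (f : W -> W -> V) : bilin f ->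
  tsum (Δ (sm x 1)) f =
  \tsum_(x1, x2 <- Δ x) \tsum_(u, v <- Δ 1)
    f (sm (x1 * act u 1) 1) (sm (x2 * (act v 1 * e)) 1).
Proof.
move=> bf; rewrite (smash_comulE smashW) tsum_nest //.
apply: eq_tsum => x1 x2; rewrite tsum_nest //.
transitivity (\tsum_(u, v <- Δ (1 : H)) \tsum_(u0, u1 <- rho u)
   f (sm x1 u0) (sm (x2 * u1) v)).
  apply: eq_tsum => u v; rewrite tsum_nest //; apply: eq_tsum => u0 u1.
  exact: tsum_pure.
rewrite (coact_unitE (f := fun u0 u1 v => f (sm x1 u0) (sm (x2 * u1) v)));
  last by lin.
transitivity (\tsum_(u, v <- Δ (1 : H)) \tsum_(u', v' <- Δ (1 : H))
    f (sm (x1 * act u 1) 1) (sm (x2 * θ u' * act v 1) v')).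
  (* Insert [εt] on both legs, move them across, then drop [εt] again. *)
  rewrite -(comul1_eps_t_l (f := fun u v => \tsum_(u', v' <- Δ 1)
    f (sm x1 u) (sm (x2 * θ u') (v * v'))) cc); last by lin.
  rewrite -(comul1_eps_t (f := fun u v => \tsum_(u', v' <- Δ 1)
    f (sm x1 (εt u)) (sm (x2 * θ u') (v * v')))); last by lin.
  under eq_tsum => u v do (rewrite smash_eps_t;
    under eq_tsum => u' v' do rewrite smash_eps_tM).
  rewrite (comul1_eps_t (f := fun u v => \tsum_(u', v' <- Δ 1)
    f (sm (x1 * act (εt u) 1) 1) (sm (x2 * θ u' * act v 1) v'))); last by lin.
  by rewrite (comul1_eps_t_l (f := fun u v => \tsum_(u', v' <- Δ 1)
    f (sm (x1 * act u 1) 1) (sm (x2 * θ u' * act v 1) v')) cc) //; lin.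
apply: eq_tsum => u v.
rewrite -(comul1_eps_t (f := fun u' v' =>
    f (sm (x1 * act u 1) 1) (sm (x2 * θ u' * act v 1) v'))); last by lin.
under eq_tsum => u' v' do rewrite smash_eps_t.
rewrite (comul1_eps_t (f := fun u' v' => f (sm (x1 * act u 1) 1)
    (sm (x2 * θ u' * act v 1 * act v' 1) 1))); last by lin.
rewrite /smash_unit (@tsum_map _ _ _ _ _ (fun z => f (sm (x1 * act u 1) 1)
    (sm (x2 * (act v 1 * z)) 1))); last by lin.
apply: eq_tsum => u' v'; congr (f _ (sm _ _)).
by rewrite !mulrA; congr (_ * _); rewrite mAC.
Qed.

Lemma smash_eta1 : η 1 = e.
Proof.
transitivity (\tsum_(u, v <- Δ (1 : H)) \tsum_(u', v' <- Δ (1 : H))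
    act u 1 * θ u' * act (v * v') 1).
  by apply: (coact_unitE (f := fun u0 u1 v => act u0 1 * u1 * act v 1)); lin.
rewrite -(comul1_eps_t (f := fun u v => \tsum_(u', v' <- Δ 1)
    act u 1 * θ u' * act (v * v') 1)); last by lin.
under eq_tsum => u v do under eq_tsum => u' v' do rewrite act_eps_tM1 //.
rewrite (comul1_eps_t (f := fun u v => \tsum_(u', v' <- Δ 1)
    act u 1 * θ u' * (act v 1 * act v' 1))); last by lin.
transitivity (\tsum_(u, v <- Δ (1 : H)) act u 1 * act v 1 * e).
  apply: eq_tsum => u v.
  rewrite /smash_unit (@tsum_map _ _ _ _ _ (fun z => act u 1 * act v 1 * z));
    last by lin.
  apply: eq_tsum => u' v'.
  by rewrite !mulrA; congr (_ * _); rewrite mAC.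
rewrite -(@tsum_map _ _ _ _ _ (fun z => z * e)); last by lin.
by rewrite act_mul1 // (act1 actP) mul1r.
Qed.

Lemma smash_counit1 x : ε (sm x 1) = ε (x * e).
Proof. by rewrite smash_counit_eta smash_eta1. Qed.

(** In the counit expansion of [sm x 1] every term carries a factor [e] from the second leg of the
    coproduct, and a second [e] is absorbed by idempotence. *)
Lemma smash_unit1 x : sm (x * e) 1 = sm x 1.
Proof.
suff [c cP] : exists c, forall x, sm x 1 = sm (x * (c * e)) 1.
  by rewrite [LHS]cP [RHS]cP -mulrA [e * _]mCA smash_unit_idem.
(* The factor [εt (act u 1 * e)] is what [counit_comul_l] leaves when the counit is applied to the
   first leg. *)
exists (\tsum_(u, v <- Δ 1) εt (act u 1 * e) * act v 1) => {}x.
have idl : linear (fun w : W => w) by lin.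
rewrite -[LHS](counitlE _ idl) smash_comul1; last by lin.
rewrite exchange_tsum.
transitivity (\tsum_(u, v <- Δ (1 : H))
    sm (x * εt (act u 1 * e) * (act v 1 * e)) 1).
  apply: eq_tsum => u v.
  rewrite -(counit_comul_l x (act u 1 * e)
    (f := fun y => sm (y * (act v 1 * e)) 1)); last by lin.
  by apply: eq_tsum => x1 x2; rewrite smash_counit1 -mulrA.
rewrite (@tsum_map _ _ _ _ _ (fun z => sm (x * (z * e)) 1)); last by lin.
by apply: eq_tsum => u v; rewrite !mulrA.
Qed.

Lemma smash_unitE x t : sm (x * e) t = sm x t.
Proof. by rewrite -[x * e]mulr1 -smash_mul1 smash_unit1 smash_mul1 mulr1. Qed.

(** Contracting the coproduct of [sm 1 1] leaves [εt] of [act u 1 * (x * η h)] in front of [a]; as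
    [a] is an integral, this [εt] can be removed. Then [e] is absorbed and the actions of [u] and
    [v] on [1] combine to [1]. *)
Lemma eps_t_smash_mul_integral x h a t : left_integral a -> left_integral t ->
  εt (sm x h) * sm a t = sm (x * η h * a) t.
Proof.
move=> int_a int_t.
rewrite (@eps_tE _ _ _ _ (fun w => w * sm a t)); last by lin.
rewrite (smash1 smashW) smash_comul1; last by lin.
rewrite exchange_tsum.
transitivity (\tsum_(u, v <- Δ (1 : H))
    sm (act u 1 * act v 1 * (x * η h * a)) t).
  apply: eq_tsum => u v.
  transitivity (\tsum_(a1, a2 <- Δ (1 : A))
    ε (a1 * (act u 1 * (x * η h))) *: sm (a2 * (act v 1 * e * a)) t).
    apply: eq_tsum => a1 a2.
    by rewrite !smash_mul1 smash_counit_eta !mulrA.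
  rewrite (counit_comul_l _ _ (f := fun y => sm (y * (act v 1 * e * a)) t));
    last by lin.
  rewrite mul1r -[RHS]smash_unitE; congr sm.
  transitivity (act v 1 * e * (act u 1 * (x * η h) * a)).
    by rewrite [act u 1 * _ * a]int_a [LHS]mCA.
  rewrite -!mulrA [e * _]mC -!mulrA; exact: mCA.
rewrite -(@tsum_map _ _ _ _ _ (fun z => sm (z * _) t)); last by lin.
by rewrite act_mul1 // (act1 actP) mul1r.
Qed.

(** As [εs] is multiplicative, [eps_s_coact_comul] applies and brings the two actions onto one
    coproduct, where they merge. *)
Lemma eps_s_smash_eta h :
  εs (η h) = \tsum_(h0, h1 <- rho h) εs (act h0 1) * εs h1.
Proof.
transitivity (\tsum_(h1, h2 <- Δ h) \tsum_(h10, h11 <- rho h1)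
    εs (act h10 1) * εs (act h2 1) * εs h11).
  rewrite (@tsum_map _ _ _ _ _ (fun z => εs z)); last by lin.
  apply: eq_tsum => h1 h2.
  rewrite (@tsum_map _ _ _ _ _ (fun z => εs z)); last by lin.
  by apply: eq_tsum => h10 h11; rewrite !eps_sM // mAC.
rewrite (eps_s_coact_comul rhoP h (f := fun x y z =>
    εs (act x 1) * εs (act y 1) * z) mC); last by lin.
apply: eq_tsum => h0 h1.
rewrite -[act h0 1](act_mul1 actP) (@tsum_map _ _ _ _ _ (fun z => εs z * εs h1));
  last by lin.
by apply: eq_tsum => h01 h02; rewrite eps_sM.
Qed.

(** In front of an integral [h11] may be replaced by [εs h11], which opens the way to
    [eps_s_coact_comul]. *)
Lemma smash_eta_integral h a : left_integral a ->
  η h * a = \tsum_(h0, h1 <- rho h) act h0 1 * εs h1 * a.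
Proof.
move=> int_a.
transitivity (\tsum_(h1, h2 <- Δ h) \tsum_(h10, h11 <- rho h1)
    act h10 1 * act h2 1 * εs h11 * a).
  rewrite (@tsum_map _ _ _ _ _ (fun z => z * a)); last by lin.
  apply: eq_tsum => h1 h2.
  rewrite (@tsum_map _ _ _ _ _ (fun z => z * a)); last by lin.
  apply: eq_tsum => h10 h11.
  by rewrite [in LHS]mAC -!mulrA left_integral_eps_s.
rewrite (eps_s_coact_comul rhoP h (f := fun x y z =>
    act x 1 * act y 1 * z * a) mC); last by lin.
apply: eq_tsum => h0 h1.
rewrite -[act h0 1](act_mul1 actP).
by rewrite (@tsum_map _ _ _ _ _ (fun z => z * εs h1 * a)) //; lin.
Qed.

(* The right counit axiom of [W] at [sm x t]. *)
Lemma smash_counit_expand x t :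
  sm x t =
  \tsum_(t1, t2 <- Δ t) \tsum_(t10, t11 <- rho t1)
    sm (x * εs (t11 * act t2 1)) t10.
Proof.
have idl : linear (fun w : W => w) by lin.
have tl : bilin (fun v w : W => ε w *: v) by lin.
rewrite -[LHS](counitrE _ idl) (smash_comulE smashW) tsum_nest //.
transitivity (\tsum_(t1, t2 <- Δ t) \tsum_(t10, t11 <- rho t1)
    sm (x * εs (t11 * η t2)) t10).
  under eq_tsum => x1 x2 do (rewrite tsum_nest //;
    under eq_tsum => t1 t2 do rewrite tsum_nest //).
  rewrite exchange_tsum; apply: eq_tsum => t1 t2.
  rewrite exchange_tsum; apply: eq_tsum => t10 t11.
  rewrite -(counit_comul_r x (t11 * η t2) mC (f := fun y => sm y t10));
    last by lin.
  by apply: eq_tsum => x1 x2; rewrite tsum_pure // smash_counit_eta mulrA.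
transitivity (\tsum_(t1, t2 <- Δ t) \tsum_(t10, t11 <- rho t1)
    \tsum_(t20, t21 <- rho t2)
    sm (x * (εs (act t20 1) * εs (t11 * t21))) t10).
  apply: eq_tsum => t1 t2; apply: eq_tsum => t10 t11.
  rewrite eps_sM // eps_s_smash_eta.
  rewrite (@tsum_map _ _ _ _ _ (fun z => sm (x * (εs t11 * z)) t10)); last by lin.
  by apply: eq_tsum => t20 t21; rewrite eps_sM // [εs t11 * _]mCA.
(* Two coactions are fused into the single coaction of [t], which is then exchanged for a coaction
   on the first leg [t1] alone. *)
rewrite -(coact_comulE rhoP t (f := fun a b c =>
    sm (x * (εs (act b 1) * εs c)) a)); last by lin.
rewrite -(eps_s_coact_comul rhoP t (f := fun a b c =>
    sm (x * (εs (act b 1) * c)) a) mC); last by lin.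
apply: eq_tsum => t1 t2; apply: eq_tsum => t10 t11.
by rewrite mC -eps_sM // [act t2 1 * _]mC mC.
Qed.

End InducedWeakHopf.

End Smash.

(** * Integrals of the smash product *)

Theorem proposition5p10 (K : fieldType) (H A : weakHopfType K)
    (act : H -> A -> A) (rho : {linear H -> (H ⊗ A)%type})
    (compat : is_compatible_pair act rho)
    (cond1 : forall h : H,
      \tsum_(u, v <- Δ (1 : H)) \tsum_(h0, h1 <- rho h) \tsum_(v0, v1 <- rho v)
        act (u * h0) 1 ⊗ (antipode h1 * εs v1) ⊗ v0 =
      \tsum_(u, v <- Δ (1 : H)) \tsum_(u0, u1 <- rho u)
      \tsum_(h0, h1 <- rho h) \tsum_(v0, v1 <- rho v)
        εt (act (u0 * h0) 1) ⊗ (εt h1 * εs v1 * u1) ⊗ v0)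
    (cond2 : forall h : H,
      \tsum_(h1, h' <- Δ h) \tsum_(h2, h3 <- Δ h')
      \tsum_(h10, h11 <- rho h1) \tsum_(h20, h21 <- rho h2)
        (εs (h11 * h21) * act (antipode h10) 1) ⊗ (antipode h20 * h3) =
      \tsum_(u, v <- Δ (1 : H)) \tsum_(h0, h1 <- rho h) \tsum_(v0, v1 <- rho v)
        (εs (h1 * v1) * εs (act (h0 * u) 1)) ⊗ v0)
    (W : weakHopfType K) (i : {linear W -> (A ⊗ H)%type}) (sm : A -> H -> W)
    (smashW : is_smash act rho i sm)
    (alpha : A) (t : H)
    (int_alpha : left_integral alpha) (int_t : left_integral t)
    (cond_int : forall h : H,
      \tsum_(t1, t2 <- Δ t) \tsum_(t10, t11 <- rho t1)
        (act h alpha * εs (t11 * act t2 1)) ⊗ t10 =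
      \tsum_(h0, h1 <- rho h)
      \tsum_(t1, t2 <- Δ t) \tsum_(t10, t11 <- rho t1)
        (act h0 1 * εs h1 * alpha * εs (t11 * act t2 1)) ⊗ t10) :
  left_integral (sm alpha t).
Proof.
have sm_bl := smash_bilin compat smashW.
have act_bl : bilin act := act_bilin (wmp_module (cwmp_matched compat)).
have sm_gen x h : sm x h * sm alpha t = εt (sm x h) * sm alpha t.
  rewrite (smash_mul_integral compat smashW) //.
  rewrite (eps_t_smash_mul_integral compat smashW) // -mulrA.
  rewrite (smash_eta_integral compat) //.
  have tl : bilin (fun a h => sm (x * a) h) by lin.
  have E := congr1 (fun s => tsum s (fun a h => sm (x * a) h)) (cond_int h).
  (* The counit expansion produces the trailing factor [εs (t11 * act t2 1)] present on both sides
     of [cond_int]; expanding back afterwards removes it. *)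
  rewrite (smash_counit_expand compat smashW).
  transitivity (tsum (\tsum_(t1, t2 <- Δ t) \tsum_(t10, t11 <- rho t1)
     (act h alpha * εs (t11 * act t2 1)) ⊗ t10) (fun a h => sm (x * a) h)).
    rewrite tsum_nest //; apply: eq_tsum => t1 t2.
    rewrite tsum_nest //; apply: eq_tsum => t10 t11.
    by rewrite tsum_pure // mulrA.
  rewrite [LHS]E tsum_nest //.
  rewrite (@tsum_map _ _ _ _ _ (fun z => sm (x * z) t)); last by lin.
  apply: eq_tsum => h0 h1; rewrite (smash_counit_expand compat smashW).
  rewrite tsum_nest //; apply: eq_tsum => t1 t2.
  rewrite tsum_nest //; apply: eq_tsum => t10 t11.
  by rewrite tsum_pure // !mulrA.
move=> w; have [z iw] := (smash_image smashW (i w)).1 (ex_intro _ w erefl).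
(* A preimage [z] of [i w] under [smash_underover] writes [w] as a sum of generators, to which
   [sm_gen] applies. *)
have -> : w = tsum z sm.
  have ul := smash_underover_linear rho act_bl.
  apply: (smash_inj smashW); rewrite iw -{1}[z]tsum_tpure.
  rewrite (tsum_map _ _ ul) (@tsum_map _ _ _ _ _ (fun w => i w)); last by lin.
  by apply: eq_tsum => x h; rewrite (smashE smashW).
rewrite (@tsum_map _ _ _ _ _ (fun w => w * sm alpha t)); last by lin.
rewrite (@tsum_map _ _ _ _ _ (fun w => εt w * sm alpha t)); last by lin.
exact: eq_tsum.
Qed.
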